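(* Let $h>0$. The set of functions $f\in C^{\nearrow h}$ such that $f\notin C^h(t)$ for every $t\in[0,1]$ is prevalent in $C^{\nearrow h}$.
   Context: For $\alpha>0$ non-integer, $C^\alpha([0,1])$ is the usual Hölder space of order $\alpha$ on $[0,1]$ (for integer $\alpha$ it is replaced by the space of functions whose wavelet coefficients $c_{j,k}$ on $[0,1]$ satisfy $\sup_{j}\sup_{0\le k<2^j}2^{\alpha j}|c_{j,k}|<\infty$, which does not affect the intersection below). $C^{\nearrow h}=\bigcap_{\alpha<h}C^\alpha([0,1])$ (intersection over $\alpha\in(0,h)$) is a Fréchet space for the topology generated by the norms of the spaces $C^\alpha([0,1])$, $\alpha<h$. For $t\in[0,1]$, $C^h(t)$ is the set of functions $f$ such that $\limsup_{s\to t}\frac{|f(s)-f(t)|}{|s-t|^h}<+\infty$. Prevalence: in a complete metric vector space $E$, a Borel set $A\subset E$ is Haar-null if there exists a compactly supported probability measure $\mu$ on $E$ such that $\mu(x+A)=0$ for all $x\in E$. A subset of $E$ is Haar-null if it is contained in a Haar-null Borel set. The complement of a Haar-null set is called prevalent. *)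

(* Defs.v *)
From HB Require Import structures.
From mathcomp Require Import all_boot all_order all_algebra.
From mathcomp Require Import all_classical all_reals all_analysis.
From mathcomp Require Import lra.

Set Implicit Arguments.
Unset Strict Implicit.
Unset Printing Implicit Defensive.

Import Order.TTheory GRing.Theory Num.Theory.
Import numFieldNormedType.Exports.

Local Open Scope classical_set_scope.
Local Open Scope ring_scope.

Definition borel_of (R : realType) (E : topologicalLmodType R) : Type :=
  g_sigma_algebraType (@open E).

HB.instance Definition _ (R : realType) (E : topologicalLmodType R) :=
  Measurable.copy (borel_of E)
    (g_sigma_algebraType (T := (E : zmodType)) (@open E)).

(* Prevalence is usually considered in complete metric vector spaces; neither
   completeness nor metrizability is needed to state it. In a metric space,
   [measurable K] below follows from [compact K]. *)
Section prevalence.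
Context (R : realType) (E : topologicalLmodType R).

Definition compactly_supported (mu : probability (borel_of E) R) :=
  exists K : set E,
    [/\ compact K, measurable (K : set (borel_of E)) & mu (~` K) = 0%E].

Definition haar_null_borel (A : set E) :=
  measurable (A : set (borel_of E)) /\
  exists mu : probability (borel_of E) R, compactly_supported mu /\
    forall x : E, mu [set x + a | a in A] = 0%E.

Definition haar_null (A : set E) :=
  exists2 B : set E, haar_null_borel B & A `<=` B.

Definition prevalent (A : set E) := haar_null (~` A).

End prevalence.

(* [set_type] carries the subspace topology, so that limits at a point of
   [0, 1] are limits within [0, 1] (one-sided at the endpoints). *)
Definition unit_interval (R : realType) : set R := `[0, 1]%classic.
Arguments unit_interval : clear implicits.

Notation "'I01' R" := (set_type (unit_interval R)) (at level 10, R at level 9).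

Section holder.
Context (R : realType).
Implicit Types (f g : I01 R -> R) (t : I01 R) (a b : R).

Definition diff_quot f t (s : I01 R) : R := (f s - f t) / (\val s - \val t).

Definition derivable01 f t := cvg (diff_quot f t s @[s --> t^']).

Definition derive01 f : I01 R -> R :=
  fun t => lim (diff_quot f t s @[s --> t^']).

Definition derive01n k f : I01 R -> R := iter k derive01 f.

Definition derivable01_upto n f :=
  forall k, (k < n)%N -> forall t, derivable01 (derive01n k f) t.

Definition sup_norm f : \bar R := ereal_sup [set `|f t|%:E | t in setT].

Definition holder_seminorm b f : \bar R :=
  ereal_sup [set (`|f st.1 - f st.2| / `|\val st.1 - \val st.2| `^ b)%:E
            | st in [set st : I01 R * I01 R | st.1 != st.2]].

(* The norm of [C^n,b] with n = floor a and b = a - n. *)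
Definition holder_norm a f : \bar R :=
  (\sum_(0 <= k < (Num.truncn a).+1) sup_norm (derive01n k f)
   + holder_seminorm (a - (Num.truncn a)%:R) (derive01n (Num.truncn a) f))%E.

(* The usual space [C^a] only for non-integer [a > 0]. *)
Definition holder a : set (I01 R -> R) :=
  [set f | derivable01_upto (Num.truncn a) f /\ (holder_norm a f < +oo)%E].

Definition pointwise_holder h t : set (I01 R -> R) :=
  [set f | (limf_esup (fun s : I01 R =>
              (`|f s - f t| / `|\val s - \val t| `^ h)%:E) t^' < +oo)%E].

End holder.

Section holder_theory.
Context (R : realType).
Implicit Types (f g : I01 R -> R) (t : I01 R) (a b : R).

Lemma I01P t : 0 <= \val t <= 1.
Proof. by have := valP t; rewrite inE /unit_interval /= in_itv. Qed.

Lemma near_in01 (x e : R) : 0 <= x /\ x <= 1 -> 0 < e ->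
  exists u : R, [/\ 0 <= u <= 1, u != x & ball x e u].
Proof.
move=> [x0 x1] e0; pose d := Num.min (e / 2) (1 / 2).
have d0 : 0 < d by rewrite lt_min !divr_gt0.
have de : d < e by rewrite gt_min; apply/orP; left; lra.
have d12 : d <= 1 / 2 by rewrite ge_min lexx orbT.
clearbody d; have [xh|xh] := leP x (1 / 2).
  exists (x + d); split; [lra|lra|].
  by rewrite -ball_normE /= opprD addNKr normrN gtr0_norm.
exists (x - d); split; [lra|lra|].
by rewrite -ball_normE /= subKr gtr0_norm.
Qed.

Lemma dnbhs01_proper t : ProperFilter t^'.
Proof.
split; last exact: dnbhs_filter.
rewrite /dnbhs withinE => -[A + Adef].
rewrite nbhsE => -[_ [[V oV <-] Vt] VA].
have /nbhs_ballP[e e0 eV] : nbhs (\val t) V by exact: open_nbhs_nbhs.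
have /andP[t0 t1] := I01P t.
have [u [u01 ut ub]] := near_in01 (conj t0 t1) e0.
have uP : u \in unit_interval R by rewrite inE /unit_interval /= in_itv.
have : (A `&` (fun y => y != t)) (exist _ u uP).
  split; first by apply: VA; apply: eV.
  by apply: contraNN ut => /eqP <-.
by rewrite -Adef => -[].
Qed.


#[local] Existing Instance dnbhs01_proper.

Lemma diff_quot_lin a f g t :
  diff_quot (a *: f + g) t = (fun s => a * diff_quot f t s + diff_quot g t s).
Proof.
apply/funext => s; rewrite /diff_quot !fctE mulrA -mulrDl; congr (_ / _).
by rewrite mulrBr opprD addrACA.
Qed.

Lemma derivable01_lin a f g t : derivable01 f t -> derivable01 g t ->
  derivable01 (a *: f + g) t.
Proof.
move=> df dg; rewrite /derivable01 diff_quot_lin.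
by apply: is_cvgD => //; apply: is_cvgMr.
Qed.

Lemma derive01_lin a f g t : derivable01 f t -> derivable01 g t ->
  derive01 (a *: f + g) t = a * derive01 f t + derive01 g t.
Proof.
move=> df dg; rewrite /derive01 diff_quot_lin limD//; last exact: is_cvgMr.
by rewrite limM//; [rewrite lim_cst|exact: is_cvg_cst].
Qed.

Lemma derive01n_lin n a f g : derivable01_upto n f -> derivable01_upto n g ->
  forall k, (k <= n)%N ->
  derive01n k (a *: f + g) = a *: derive01n k f + derive01n k g.
Proof.
move=> df dg; elim=> [//|k IH kn].
rewrite [LHS]/= -/(derive01n _ _) IH ?(ltnW kn)//.
by apply/funext => t; rewrite derive01_lin//; [exact: df|exact: dg].
Qed.

Lemma derivable01_upto_lin n a f g :
  derivable01_upto n f -> derivable01_upto n g ->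
  derivable01_upto n (a *: f + g).
Proof.
move=> df dg k kn t; rewrite (derive01n_lin _ df dg)//; last exact: ltnW.
by apply: derivable01_lin; [exact: df|exact: dg].
Qed.

Lemma diff_quot0 t : diff_quot 0 t = cst 0.
Proof. by apply/funext => s; rewrite /diff_quot !fctE subrr mul0r. Qed.

Lemma derive01n0 k : derive01n k (0 : I01 R -> R) = 0.
Proof.
elim: k => [//|k IH]; rewrite /= -/(derive01n _ _) IH.
by apply/funext => t; rewrite /derive01 diff_quot0 lim_cst.
Qed.

Lemma derivable01_upto0 n : derivable01_upto n (0 : I01 R -> R).
Proof.
move=> k _ t; rewrite derive01n0 /derivable01 diff_quot0.
exact: is_cvg_cst.
Qed.

Definition I01_0 : I01 R.
Proof. by exists 0; rewrite inE /unit_interval /= in_itv /= lexx ler01. Defined.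
Definition I01_1 : I01 R.
Proof. by exists 1; rewrite inE /unit_interval /= in_itv /= lexx ler01. Defined.

Lemma sup_norm_ge0 f : (0 <= sup_norm f)%E.
Proof.
apply: le_trans (ereal_sup_ubound _); last by exists I01_0.
by rewrite lee_fin.
Qed.

Lemma holder_seminorm_ge0 b f : (0 <= holder_seminorm b f)%E.
Proof.
apply: le_trans (ereal_sup_ubound _); last first.
  exists (I01_0, I01_1) => //=.
  by apply/eqP => /(congr1 val) /= /eqP; rewrite eq_sym oner_eq0.
by rewrite lee_fin divr_ge0// powR_ge0.
Qed.

Lemma sup_norm_lin a f g :
  (sup_norm (a *: f + g)%R <= `|a|%:E * sup_norm f + sup_norm g)%E.
Proof.
apply: ge_ereal_sup => _ [t _ <-].
apply: (@le_trans _ _ (`|a|%:E * `|f t|%:E + `|g t|%:E)%E).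
  by rewrite -EFinM -EFinD lee_fin fctE (le_trans (ler_normD _ _))// normrM.
apply: leeD; last by apply: ereal_sup_ubound; exists t.
by apply: lee_wpmul2l; rewrite ?lee_fin//; apply: ereal_sup_ubound; exists t.
Qed.

Lemma holder_seminorm_lin b a f g :
  (holder_seminorm b (a *: f + g)%R
   <= `|a|%:E * holder_seminorm b f + holder_seminorm b g)%E.
Proof.
apply: ge_ereal_sup => _ [[s t] /= st <-].
pose d := `|\val s - \val t| `^ b.
apply: (@le_trans _ _
    (`|a|%:E * (`|f s - f t| / d)%:E + (`|g s - g t| / d)%:E)%E).
  rewrite -EFinM -EFinD lee_fin !fctE mulrA -mulrDl ler_wpM2r//.
  by rewrite opprD addrACA -scalerBr (le_trans (ler_normD _ _))// normrM.
apply: leeD; last by apply: ereal_sup_ubound; exists (s, t).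
by apply: lee_wpmul2l; rewrite ?lee_fin//; apply: ereal_sup_ubound; exists (s, t).
Qed.

Lemma holder_norm_ge0 a f : (0 <= holder_norm a f)%E.
Proof.
apply: adde_ge0; last exact: holder_seminorm_ge0.
by apply: sume_ge0 => k _; exact: sup_norm_ge0.
Qed.

Lemma holder_norm_lin b a f g :
  derivable01_upto (Num.truncn b) f -> derivable01_upto (Num.truncn b) g ->
  (holder_norm b (a *: f + g)%R <= `|a|%:E * holder_norm b f + holder_norm b g)%E.
Proof.
move=> df dg; rewrite /holder_norm ge0_muleDr; last 2 first.
- by apply: sume_ge0 => k _; exact: sup_norm_ge0.
- exact: holder_seminorm_ge0.
rewrite addeACA; apply: leeD; last first.
  by rewrite (derive01n_lin _ df dg)//; exact: holder_seminorm_lin.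
rewrite ge0_sume_distrr; last by move=> k _; exact: sup_norm_ge0.
rewrite -big_split /= !big_mkord; apply: lee_sum => k _.
rewrite (derive01n_lin _ df dg); first exact: sup_norm_lin.
by rewrite -ltnS.
Qed.

Lemma sup_norm0 : sup_norm (0 : I01 R -> R) = 0%E.
Proof.
apply/eqP; rewrite eq_le sup_norm_ge0 andbT.
by apply: ge_ereal_sup => _ [t _ <-]; rewrite normr0.
Qed.

Lemma holder_seminorm0 b : holder_seminorm b (0 : I01 R -> R) = 0%E.
Proof.
apply/eqP; rewrite eq_le holder_seminorm_ge0 andbT.
by apply: ge_ereal_sup => _ [t _ <-]; rewrite subrr normr0 mul0r.
Qed.

Lemma holder_norm0 a : holder_norm a (0 : I01 R -> R) = 0%E.
Proof.
rewrite /holder_norm derive01n0 holder_seminorm0 adde0 big1// => k _.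
by rewrite derive01n0 sup_norm0.
Qed.

Lemma holder0 b : holder b (0 : I01 R -> R).
Proof. by split; [exact: derivable01_upto0|rewrite holder_norm0]. Qed.

Lemma holder_lin b a f g : holder b f -> holder b g -> holder b (a *: f + g).
Proof.
move=> [df nf] [dg ng]; split; first exact: derivable01_upto_lin.
apply: le_lt_trans (holder_norm_lin _ df dg) _; apply: lte_add_pinfty => //.
have : holder_norm b f \is a fin_num by rewrite ge0_fin_numE// holder_norm_ge0.
by move=> /fineK <-; rewrite -EFinM ltry.
Qed.

End holder_theory.

(* Integer orders are left out: this changes neither the intersection nor,
   the norms being increasing up to constants, the topology. *)
Definition holder_exponent (R : realType) (h : R) : pred R :=
  [pred a | [&& 0 < a, a < h & a \isn't a Num.int]].

Definition in_holder_below (R : realType) (h : R) : {pred I01 R -> R} :=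
  mem [set f | forall a, holder_exponent h a -> holder a f].

Record holder_below (R : realType) (h : R) := HolderBelow {
  holder_below_fun :> I01 R -> R ;
  _ : holder_below_fun \in in_holder_below h }.

Section holder_below_lmodule.
Context (R : realType) (h : R).

HB.instance Definition _ := [isSub of holder_below h for @holder_below_fun R h].
HB.instance Definition _ := [Choice of holder_below h by <:].

Lemma in_holder_below_submod_closed : submod_closed (in_holder_below h).
Proof.
split; first by rewrite inE => a _; exact: holder0.
move=> a f g /set_mem fh /set_mem gh; rewrite inE => b bh.
by apply: holder_lin; [exact: fh|exact: gh].
Qed.

HB.instance Definition _ :=
  GRing.isSubmodClosed.Build R (I01 R -> R) (in_holder_below h)
    in_holder_below_submod_closed.
HB.instance Definition _ := [SubChoice_isSubLmodule of holder_below h by <:].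

End holder_below_lmodule.

Section holder_below_topology.
Context (R : realType) (h : R).
Local Notation E := (holder_below h).
Implicit Types (f g : E) (s : seq R) (a e : R).

(* The finite intersections of balls of radius [e] for the norms of the
   spaces [C^a], which form a base of neighbourhoods of [f]. *)
Definition holder_ball s f e : set E :=
  [set g | forall a, a \in s -> (holder_norm a (g - f)%R < e%:E)%E].

Definition holder_below_nbhs f : set_system E :=
  filter_from [set se : seq R * R | all (holder_exponent h) se.1 /\ 0 < se.2]
    (fun se => holder_ball se.1 f se.2).

HB.instance Definition _ := hasNbhs.Build E holder_below_nbhs.

Lemma holder_belowP f a : holder_exponent h a -> holder a f.
Proof. by move=> ha; case: f => /= f /set_mem; exact. Qed.

Lemma holder_norm_fin f a : holder_exponent h a ->
  holder_norm a f \is a fin_num.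
Proof.
move=> /(holder_belowP f)[_ nf].
by rewrite ge0_fin_numE// holder_norm_ge0.
Qed.

Definition rnorm a f : R := fine (holder_norm a f).

Lemma rnormE f a : holder_exponent h a -> holder_norm a f = (rnorm a f)%:E.
Proof. by move=> ha; rewrite /rnorm fineK// holder_norm_fin. Qed.

Lemma rnorm_ge0 f a : 0 <= rnorm a f.
Proof. by rewrite fine_ge0// holder_norm_ge0. Qed.

Lemma rnorm_lin b f g a : holder_exponent h a ->
  rnorm a (b *: f + g) <= `|b| * rnorm a f + rnorm a g.
Proof.
move=> ha; rewrite -lee_fin EFinD EFinM -!rnormE//.
have [df _] := holder_belowP f ha; have [dg _] := holder_belowP g ha.
exact: (@holder_norm_lin R a b f g df dg).
Qed.

Lemma rnorm0 a : rnorm a 0 = 0.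
Proof. by rewrite /rnorm holder_norm0. Qed.

Lemma rnormD f g a : holder_exponent h a ->
  rnorm a (f + g) <= rnorm a f + rnorm a g.
Proof. by move=> /(rnorm_lin 1 f g); rewrite scale1r normr1 mul1r. Qed.

Lemma rnormZ b f a : holder_exponent h a -> rnorm a (b *: f) <= `|b| * rnorm a f.
Proof. by move=> /(rnorm_lin b f 0); rewrite addr0 rnorm0 addr0. Qed.

Lemma holder_ballE s f e g : all (holder_exponent h) s ->
  holder_ball s f e g <-> (forall a, a \in s -> rnorm a (g - f) < e).
Proof.
move=> /allP sh; split=> H a sa; have := H a sa.
  by rewrite (rnormE (g - f)) ?lte_fin//; exact: sh.
by rewrite (rnormE (g - f)) ?lte_fin//; exact: sh.
Qed.

Lemma holder_ball_center s f e :
  all (holder_exponent h) s -> 0 < e -> holder_ball s f e f.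
Proof. by move=> sh e0; apply/holder_ballE => // a _; rewrite subrr rnorm0. Qed.

Lemma holder_ball_sub s f e g : all (holder_exponent h) s -> 0 < e ->
  holder_ball s f e g -> exists2 d, 0 < d & holder_ball s g d `<=` holder_ball s f e.
Proof.
move=> sh e0 /(holder_ballE _ _ _ sh) gB.
have [d d0 dB] : exists2 d, 0 < d & forall a, a \in s -> rnorm a (g - f) + d <= e.
  elim: s {sh} gB => [_|b s IH gB]; first by exists 1.
  have [a sa|d d0 dB] := IH; first by apply: gB; rewrite inE sa orbT.
  exists (Num.min d (e - rnorm b (g - f))).
    by rewrite lt_min d0 subr_gt0 gB// mem_head.
  move=> a; rewrite inE => /predU1P[->|sa].
    by rewrite -lerBrDl ge_min lexx orbT.
  by rewrite (le_trans _ (dB _ sa))// lerD2l ge_min lexx.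
exists d; first exact: d0.
move=> k /(holder_ballE _ _ _ sh) kB; apply/(holder_ballE _ _ _ sh) => a sa.
rewrite (lt_le_trans _ (dB a sa))// -(subrKA g) addrC.
rewrite (le_lt_trans (rnormD _ _ _))//; first exact: (allP sh).
by rewrite ltrD2l kB.
Qed.

Lemma holder_below_nbhs_filter f : ProperFilter (nbhs f).
Proof.
apply: filter_from_proper; last first.
  by move=> [s e] /= [sh e0]; exists f; exact: holder_ball_center.
apply: filter_from_filter; first by exists ([::], 1).
move=> [s e] [s' e'] /= [sh e0] [sh' e0'].
exists (s ++ s', Num.min e e') => /=; first by rewrite all_cat sh lt_min e0.
have sh2 : all (holder_exponent h) (s ++ s') by rewrite all_cat sh.
move=> g /(holder_ballE _ _ _ sh2) gB.
by split; apply/holder_ballE => // a sa; have := gB a;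
  rewrite mem_cat sa ?orbT lt_min => /(_ isT)/andP[].
Qed.

Lemma holder_below_nbhs_singleton f (A : set E) : nbhs f A -> A f.
Proof. by move=> [[s e] /= [sh e0]]; apply; exact: holder_ball_center. Qed.

Lemma holder_ball_nbhs s f e g : all (holder_exponent h) s -> 0 < e ->
  holder_ball s f e g -> nbhs g (holder_ball s f e).
Proof.
by move=> sh e0 /(holder_ball_sub sh e0)[d d0 dB]; exists (s, d).
Qed.

Lemma holder_below_nbhs_nbhs f (A : set E) : nbhs f A -> nbhs f (nbhs^~ A).
Proof.
move=> [[s e] /= [sh e0] BA]; exists (s, e) => //= g gB.
have [d d0 dB] := holder_ball_sub sh e0 gB.
by exists (s, d) => //=; exact: subset_trans BA.
Qed.

HB.instance Definition _ := Nbhs_isNbhsTopological.Build E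
  holder_below_nbhs_filter holder_below_nbhs_singleton holder_below_nbhs_nbhs.

Lemma holder_below_add_continuous : continuous (fun x : E * E => x.1 + x.2).
Proof.
move=> [f g] A [[s e] /= [sh e0] BA].
exists (holder_ball s f (e / 2), holder_ball s g (e / 2)) => /=.
  by split; apply: holder_ball_nbhs => //; rewrite ?divr_gt0//;
    apply: holder_ball_center; rewrite ?divr_gt0.
move=> [u v] /= [/(holder_ballE _ _ _ sh) uB /(holder_ballE _ _ _ sh) vB].
apply: BA; apply/holder_ballE => // a sa.
rewrite opprD addrACA (le_lt_trans (rnormD _ _ _))//; first exact: (allP sh).
by rewrite (splitr e) ltrD// ?uB ?vB.
Qed.

Lemma holder_below_scale_continuous :
  continuous (fun z : R^o * E => z.1 *: z.2).
Proof.
move=> [b f] A [[s e] /= [sh e0] BA].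
have [M M0 MB] : exists2 M, 0 < M & forall a, a \in s -> rnorm a f <= M.
  elim: s {sh BA} => [|c s [M M0 MB]]; first by exists 1.
  exists (Num.max M (rnorm c f)); first by rewrite lt_max M0.
  move=> a; rewrite inE => /predU1P[->|/MB]; rewrite le_max ?lexx ?orbT//.
  by move=> ->.
pose d := Num.min 1 (e / 2 / M).
have d0 : 0 < d by rewrite lt_min ltr01 !divr_gt0.
pose e' := e / 2 / (`|b| + 1).
have e'0 : 0 < e' by rewrite !divr_gt0// ltr_wpDl.
exists (ball b d, holder_ball s f e') => /=.
  split; first exact: nbhsx_ballx.
  by apply: holder_ball_nbhs => //; exact: holder_ball_center.
move=> [c g] /= []; rewrite -ball_normE /= => cb /(holder_ballE _ _ _ sh) gB.
apply: BA; apply/holder_ballE => // a sa; have ha := allP sh _ sa.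
have -> : c *: g - b *: f = c *: (g - f) + (c - b) *: f.
  by rewrite scalerBr scalerBl addrA subrK.
rewrite (le_lt_trans (rnorm_lin _ _ _ _))//.
rewrite (splitr e) ltr_leD//.
  have cb1 : `|c| <= `|b| + 1.
    rewrite -[c](subrK b) addrC (le_trans (ler_normD _ _))// lerD2l distrC.
    by rewrite (le_trans (ltW cb))// ge_min lexx.
  rewrite (le_lt_trans (ler_wpM2r (rnorm_ge0 _ _) cb1))//.
  by rewrite mulrC -ltr_pdivlMr ?ltr_wpDl// gB.
rewrite (le_trans (rnormZ _ _ _))//.
rewrite (le_trans (ler_wpM2l (normr_ge0 _) (MB a sa)))//.
by rewrite -ler_pdivlMr// distrC (le_trans (ltW cb))// ge_min lexx orbT.
Qed.

Lemma holder_ball_convex s f e u v (l : R) :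
  all (holder_exponent h) s -> 0 < l -> l < 1 ->
  holder_ball s f e u -> holder_ball s f e v ->
  holder_ball s f e (l *: u + (1 - l) *: v).
Proof.
move=> sh l0 l1 /(holder_ballE _ _ _ sh) uB /(holder_ballE _ _ _ sh) vB.
apply/(holder_ballE _ _ _ sh) => a sa; have ha := allP sh _ sa.
have -> : l *: u + (1 - l) *: v - f = l *: (u - f) + (1 - l) *: (v - f).
  by rewrite !scalerBr addrACA -opprD -scalerDl addrC subrKC scale1r addrC.
apply: le_lt_trans (rnorm_lin _ _ _ ha) _.
apply: le_lt_trans (lerD (lexx _) (rnormZ _ _ ha)) _.
have l1' : 0 < 1 - l by rewrite subr_gt0.
rewrite (gtr0_norm l0) (gtr0_norm l1').
have -> : e = l * e + (1 - l) * e by rewrite -mulrDl addrC subrK mul1r.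
by rewrite ltrD// ltr_pM2l ?uB ?vB.
Qed.

Lemma holder_below_locally_convex :
  exists2 B : set_system E, (forall b, b \in B -> convex_set b) & basis B.
Proof.
exists [set B | exists s f e, [/\ all (holder_exponent h) s, 0 < e
                               & B = holder_ball s f e]].
  move=> B /set_mem[s [f [e [sh e0 ->]]]].
  apply/convex_setW => u v /set_mem uB /set_mem vB l l0 l1.
  exact/mem_set/holder_ball_convex.
split.
  move=> B [s [f [e [sh e0 ->]]]]; rewrite openE => g gB.
  exact: holder_ball_nbhs.
move=> f B [[s e] /= [sh e0] BB]; exists (holder_ball s f e) => //=.
by split; [exists s, f, e|exact: holder_ball_center].
Qed.

(* The factory only equips the space with its uniformity. *)
HB.instance Definition _ := PreTopologicalLmod_isTvs.Build R E
  holder_below_add_continuous holder_below_scale_continuous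
  holder_below_locally_convex.
HB.instance Definition _ :=
  PreTopologicalNmodule_isTopologicalNmodule.Build E holder_below_add_continuous.
HB.instance Definition _ :=
  TopologicalNmodule_isTopologicalLmodule.Build R E
    holder_below_scale_continuous.
HB.instance Definition _ :=
  Uniform_isTvs.Build R E holder_below_locally_convex.

End holder_below_topology.

(* Main.v *)
Require Import Defs.
From HB Require Import structures.
From mathcomp Require Import all_boot all_order all_algebra.
From mathcomp Require Import all_classical all_reals all_analysis.
From mathcomp Require Import ring lra.

Set Implicit Arguments.
Unset Strict Implicit.
Unset Printing Implicit Defensive.

Import Order.TTheory GRing.Theory Num.Theory.
Import numFieldNormedType.Exports.
Local Open Scope classical_set_scope.
Local Open Scope ring_scope.

(** The Haar-null set is witnessed by the law of the random lacunary series

      X(t) = sum_j d_j 2^(-hj) cos(2 pi 2^j t),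

    where d_0, d_1, ... are independent and d_j is uniform on {0, ..., j}.
    The range of d_j grows slower than any exponential, so that all these
    series lie in C^a for every a < h, and they form a compact set, the
    continuous image of a product of finite sets ([digit_fun_continuous],
    [random_law_compactly_supported]). But it is unbounded, which makes the
    oscillation of X at scale 2^(-i) exceed any fixed multiple of 2^(-hi) with
    a probability that tends to 1.

    If f is in C^h(t), then for some C and J and all i >= J, the increment of f
    between the left end and the midpoint of a dyadic interval of length 2^(-i)
    that contains t is at most C 2^(-hi) ([pointwise_holder_slow]). The terms of
    X of index greater than i take equal values at these two points, and the
    term of index i changes by -2 d_i 2^(-hi) ([lacunary_dyadic_increment]).
    Hence, whatever the translate g, once d_0, ..., d_(i-1) are known, the
    condition on the increment of X - g leaves at most C + 1 of the i + 1
    values of d_i ([small_increment_digit]).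

    Follow the ancestors of one dyadic interval of generation n. The conditions
    for J <= i < n are met with probability at most a constant times
    (C + 1)^n / n!. There are 2^n such intervals, and 2^n (C + 1)^n / n! tends
    to 0. Therefore X - g almost surely belongs to no C^h(t)
    ([random_slow_null]). The argument only compares values at two points, so
    it is the same for h > 1, where no polynomial is subtracted in C^h(t).

    All digits are read off one uniform variable x in [0, 1]: the integer part
    of n! x encodes (d_0, ..., d_(n-1)) in mixed radix, so that a set of
    prefixes of length n becomes a set of intervals of length 1/n!
    ([rank_cover], [lebesgue_rank_le]). *)

(** * Hoelder bounds for the cosine *)
Section trigonometric_bounds.
Context {R : realType}.
Implicit Types x y b : R.

Lemma cos_lipschitz x y : `|cos x - cos y| <= `|x - y|.
Proof.
wlog xy : x y / x <= y => [wl|].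
  by case: (leP x y) => [|/ltW] /wl//; rewrite distrC (distrC y).
have cD (z : R) : z \in `]x, y[ -> is_derive z 1 (@cos R) (- sin z).
  by move=> _; exact: is_derive_cos.
have cC : {within `[x, y], continuous (@cos R)}.
  by apply: continuous_subspaceT; exact: continuous_cos.
have [c _ cE] := MVT_segment xy cD cC.
rewrite distrC cE normrM normrN (distrC x) ler_piMl//.
by rewrite ler_norml sin_geN1 sin_le1.
Qed.

Lemma sin_lipschitz x y : `|sin x - sin y| <= `|x - y|.
Proof.
rewrite -!cosBpihalf (le_trans (cos_lipschitz _ _))//.
by rewrite opprB addrA subrK.
Qed.

Lemma norm_cos_le1 x : `|cos x| <= 1.
Proof. by rewrite ler_norml cos_geN1 cos_le1. Qed.

Lemma norm_sin_le1 x : `|sin x| <= 1.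
Proof. by rewrite ler_norml sin_geN1 sin_le1. Qed.

Lemma cos_taylor1 x y : `|cos (x + y) - cos x + y * sin x| <= `|y| ^+ 2.
Proof.
wlog y0 : x y / 0 <= y => [wl|].
  case: (leP 0 y) => [|/ltW y0]; first exact: wl.
  have := wl (- x) (- y); rewrite oppr_ge0 => /(_ y0).
  by rewrite -opprD !cosN sinN mulrNN normrN.
have cD (z : R) : z \in `]x, x + y[ -> is_derive z 1 (@cos R) (- sin z).
  by move=> _; exact: is_derive_cos.
have cC : {within `[x, x + y], continuous (@cos R)}.
  by apply: continuous_subspaceT; exact: continuous_cos.
have xy : x <= x + y by rewrite lerDl.
have [c /[!in_itv]/= /andP[xc cy] ->] := MVT_segment xy cD cC.
have -> : - sin c * (x + y - x) + y * sin x = y * (sin x - sin c) by ring.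
rewrite normrM expr2 ler_wpM2l// (le_trans (sin_lipschitz _ _))//.
by rewrite distrC ger0_norm ?subr_ge0// ger0_norm// lerBlDl.
Qed.

(** Interpolation between the Lipschitz bound, which is better when
    [`|x - y| <= 1], and the trivial bound 2. *)
Lemma cos_holder b x y : 0 < b -> b < 1 ->
  `|cos x - cos y| <= 2 * `|x - y| `^ b.
Proof.
move=> b0 b1; have [xy1|/ltW xy1] := leP `|x - y| 1.
  apply: le_trans (cos_lipschitz _ _) _.
  have [->|xy0] := eqVneq `|x - y| 0; first by rewrite mulr_ge0// powR_ge0.
  have xyp : 0 < `|x - y| by rewrite lt_def xy0 /=.
  rewrite (le_trans (ger1_powR _ (ltW b1)))// ?xyp//.
  by rewrite ler_peMl ?powR_ge0// ler1n.
apply: (@le_trans _ _ (1 + 1)).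
  by rewrite (le_trans (ler_normB _ _))// lerD// norm_cos_le1.
rewrite -[leLHS]/(2%:R) ler_peMr// -(powRr0 `|x - y|).
by rewrite ler_powR// ltW.
Qed.

(** Same interpolation one order higher. The exponent [1 + b] rather than 2 is
    what the term-by-term differentiation of a series with a finite moment of
    order [1 + b] can afford. *)
Lemma cos_taylor_holder b x y : 0 < b -> b < 1 ->
  `|cos (x + y) - cos x + y * sin x| <= 2 * `|y| `^ (1 + b).
Proof.
move=> b0 b1; have [y1|/ltW y1] := leP `|y| 1.
  apply: le_trans (cos_taylor1 _ _) _.
  have [->|yn0] := eqVneq `|y| 0; first by rewrite expr0n mulr_ge0// powR_ge0.
  have yp : 0 < `|y| by rewrite lt_def yn0 /=.
  rewrite -powR_mulrn// (@le_trans _ _ (`|y| `^ (1 + b)))//.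
    by rewrite ger_powR ?yp// -[leRHS]/(1 + 1) lerD2l ltW.
  by rewrite ler_peMl ?powR_ge0// ler1n.
apply: (@le_trans _ _ (`|y| + `|y|)).
  rewrite (le_trans (ler_normD _ _))// lerD//.
    by rewrite (le_trans (cos_lipschitz _ _))// addrAC subrr add0r.
  by rewrite normrM ler_piMr// norm_sin_le1.
have -> : `|y| + `|y| = 2 * `|y| by ring.
rewrite ler_wpM2l// -[leLHS]powRr1//.
by rewrite ler_powR// lerDl ltW.
Qed.

End trigonometric_bounds.

(** * Lacunary cosine series in Hoelder spaces *)
Section dominated_series.
Context {R : realType}.
Implicit Types u v : R ^nat.

Lemma cvg_series_dominated u v : (forall j, `|u j| <= v j) ->
  cvgn (series v) -> cvgn (series u).
Proof.
move=> uv cv; apply: normed_cvg; apply: series_le_cvg cv => // j.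
  exact: normr_ge0.
exact: le_trans (normr_ge0 _) (uv j).
Qed.

Lemma norm_lim_series_dominated u v : (forall j, `|u j| <= v j) ->
  cvgn (series v) -> `|limn (series u)| <= limn (series v).
Proof.
move=> uv cv; have cu : cvgn [normed series u].
  apply: series_le_cvg cv => // j; first exact: normr_ge0.
  exact: le_trans (normr_ge0 _) (uv j).
by apply: le_trans (lim_series_norm cu) _; exact: lim_series_le.
Qed.

End dominated_series.

Section lacunary_series.
Context {R : realType}.
Implicit Types (c : R ^nat) (a b th x y : R).

Definition freq j : R := 2 ^+ j.+1 * pi.

(** The phase [th] makes the family stable under differentiation, which adds
    [pi / 2] to it. *)
Definition lacunary c th x : R :=
  limn (series (fun j => c j * cos (freq j * x + th))).

Definition lacunary01 c th : I01 R -> R := fun t => lacunary c th (\val t).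

(** A finite moment of order [a] of the frequencies, weighted by the moduli of
    the coefficients, bounds the norm of the series in C^a. *)
Definition moment_term a c j : R := `|c j| * freq j `^ a.

Definition has_moment a c := cvgn (series (moment_term a c)).

Definition moment a c : R := limn (series (moment_term a c)).

Lemma freq_ge1 j : 1 <= freq j.
Proof.
rewrite -[1]mul1r ler_pM//; last by rewrite (le_trans _ (pi_ge2 R))// ler1n.
by rewrite exprn_ege1// ler1n.
Qed.

Lemma freq_gt0 j : 0 < freq j.
Proof. exact: lt_le_trans (freq_ge1 j). Qed.

Lemma moment_term_ge0 a c j : 0 <= moment_term a c j.
Proof. by rewrite mulr_ge0// powR_ge0. Qed.

Lemma le_moment_term a b c j : a <= b -> moment_term a c j <= moment_term b c j.
Proof. by move=> ab; rewrite ler_wpM2l// ler_powR// freq_ge1. Qed.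

Lemma has_moment_le a b c : a <= b -> has_moment b c -> has_moment a c.
Proof.
move=> ab; apply: series_le_cvg => j; rewrite ?moment_term_ge0//.
exact: le_moment_term.
Qed.

Lemma moment_le a b c : a <= b -> has_moment b c -> moment a c <= moment b c.
Proof.
move=> ab cb; apply: lim_series_le => //; first exact: has_moment_le cb.
by move=> j; exact: le_moment_term.
Qed.

Lemma moment_ge0 a c : has_moment a c -> 0 <= moment a c.
Proof.
move=> ca; apply: limr_ge => //; near=> n.
by apply: sumr_ge0 => j _; exact: moment_term_ge0.
Unshelve. all: end_near. Qed.

(** Differentiating [k] times multiplies the coefficients by [freq j ^+ k],
    hence costs [k] orders of moments. *)
Lemma moment_term_shift a c k :
  moment_term a (fun j => c j * freq j ^+ k) = moment_term (k%:R + a) c.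
Proof.
apply/funext => j; rewrite /moment_term normrM normrX (gtr0_norm (freq_gt0 j)).
rewrite -mulrA -powR_mulrn ?(ltW (freq_gt0 j))// -powRD//.
by rewrite (gt_eqF (freq_gt0 j)) implybT.
Qed.

Lemma cvg_lacunary c th x : has_moment 0 c ->
  cvgn (series (fun j => c j * cos (freq j * x + th))).
Proof.
apply: cvg_series_dominated => j.
by rewrite /moment_term powRr0 normrM ler_wpM2l// norm_cos_le1.
Qed.

Lemma norm_lacunary c th x : has_moment 0 c -> `|lacunary c th x| <= moment 0 c.
Proof.
apply: norm_lim_series_dominated => j.
by rewrite /moment_term powRr0 normrM ler_wpM2l// norm_cos_le1.
Qed.

Lemma lacunaryB c c' th x : has_moment 0 c -> has_moment 0 c' ->
  lacunary c th x - lacunary c' th x = lacunary (fun j => c j - c' j) th x.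
Proof.
move=> mc mc'; rewrite /lacunary.
rewrite -lim_seriesB; [|exact: cvg_lacunary|exact: cvg_lacunary].
by congr (limn (series _)); apply/funext => j; rewrite mulrBl.
Qed.

Lemma lacunary_holder b c th x y : 0 < b -> b < 1 -> has_moment b c ->
  `|lacunary c th x - lacunary c th y| <= 2 * moment b c * `|x - y| `^ b.
Proof.
move=> b0 b1 mb; have m0 := has_moment_le (ltW b0) mb.
rewrite /lacunary -lim_seriesB; [|exact: cvg_lacunary|exact: cvg_lacunary].
have -> : 2 * moment b c * `|x - y| `^ b =
    limn (series ((2 * `|x - y| `^ b) *: moment_term b c)).
  by rewrite lim_seriesZ// mulrAC.
apply: norm_lim_series_dominated; last exact: is_cvg_seriesZ.
move=> j; rewrite !fctE -mulrBr normrM /moment_term.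
rewrite -[leRHS]/(_ * _) [leRHS]mulrCA ler_wpM2l//.
rewrite (le_trans (cos_holder _ _ b0 b1))// opprD addrACA subrr addr0.
by rewrite -mulrBr normrM powRM// (gtr0_norm (freq_gt0 j)) mulrAC mulrA.
Qed.

(** Summing the first-order expansions of the terms bounds the remainder of the
    series by a power greater than 1 of the increment. This gives the derivative
    without any exchange of limits. *)
Lemma lacunary_taylor b c th x y : 0 < b -> b < 1 -> has_moment (1 + b) c ->
  `|lacunary c th y - lacunary c th x
     - (y - x) * lacunary (fun j => c j * freq j) (th + pi / 2) x|
  <= 2 * moment (1 + b) c * `|y - x| `^ (1 + b).
Proof.
move=> b0 b1 mb; have b10 : 0 <= 1 + b by rewrite addr_ge0 ?ltW.
have m0 := has_moment_le b10 mb.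
have m1 : has_moment 0 (fun j => c j * freq j).
  have := @moment_term_shift 0 c 1; rewrite /has_moment /= => ->.
  by apply: has_moment_le mb; rewrite addr0 lerDl ltW.
rewrite /lacunary -lim_seriesB; [|exact: cvg_lacunary|exact: cvg_lacunary].
rewrite -[(y - x) * _]/((y - x) *: _) -lim_seriesZ; last exact: cvg_lacunary.
rewrite -lim_seriesB; last 2 first.
- by apply: is_cvg_seriesB; exact: cvg_lacunary.
- by apply: is_cvg_seriesZ; exact: cvg_lacunary.
have -> : 2 * moment (1 + b) c * `|y - x| `^ (1 + b) =
    limn (series ((2 * `|y - x| `^ (1 + b)) *: moment_term (1 + b) c)).
  by rewrite lim_seriesZ// mulrAC.
apply: norm_lim_series_dominated; last exact: is_cvg_seriesZ.
move=> j; rewrite !fctE /moment_term addrA cosDpihalf.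
set u := freq j * x + th; set v := freq j * (y - x).
have -> : freq j * y + th = u + v by rewrite /u /v; ring.
have -> : c j * cos (u + v) - c j * cos u - (y - x) *: (c j * freq j * - sin u)
    = c j * (cos (u + v) - cos u + v * sin u).
  by rewrite /v -[_ *: _]/(_ * _); ring.
rewrite normrM -[leRHS]/(_ * _) [leRHS]mulrCA ler_wpM2l//.
rewrite (le_trans (cos_taylor_holder _ _ b0 b1))//.
by rewrite /v normrM powRM// (gtr0_norm (freq_gt0 j)) mulrAC mulrA.
Qed.

#[local] Existing Instance dnbhs01_proper.

Lemma near_dnbhs01 (t : I01 R) (e : R) : 0 < e ->
  \forall s \near t^', s != t /\ `|\val s - \val t| < e.
Proof.
move=> e0; rewrite /dnbhs.
apply: filterI; first exact: withinT.
apply: cvg_within.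
have /cvgrPdist_lt/(_ _ e0) :=
  @initial_continuous _ _ (@set_val _ (unit_interval R)) t.
by apply: filterS => s; rewrite distrC.
Qed.

Lemma lacunary01_derive b c th t : 0 < b -> b < 1 -> has_moment (1 + b) c ->
  diff_quot (lacunary01 c th) t s @[s --> t^'] -->
  lacunary01 (fun j => c j * freq j) (th + pi / 2) t.
Proof.
move=> b0 b1 mb; apply/cvgrPdist_lt => e e0.
set M := 2 * moment (1 + b) c + 1.
have M0 : 0 < M by rewrite ltr_wpDl// mulr_ge0// moment_ge0.
(* The remainder over the increment is at most [M * `|s - t| `^ b], which is
   less than [e] within this distance. *)
have d0 : 0 < (e / M) `^ b^-1 by rewrite powR_gt0// divr_gt0.
near=> s.
have [st sd] : s != t /\ `|\val s - \val t| < (e / M) `^ b^-1.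
  by near: s; exact: near_dnbhs01.
have vst : \val s - \val t != 0.
  by rewrite subr_eq0; apply: contra_neq st => /val_inj.
have nst : 0 < `|\val s - \val t| by rewrite normr_gt0.
rewrite distrC /diff_quot -(@ltr_pM2r _ `|\val s - \val t|)// -normrM.
rewrite mulrBl divfK// [X in _ - X]mulrC.
apply: le_lt_trans (lacunary_taylor th (\val t) (\val s) b0 b1 mb) _.
rewrite powRD ?(gt_eqF nst) ?implybT// powRr1// mulrA mulrAC ltr_pM2r//.
have : `|\val s - \val t| `^ b < e / M.
  have -> : e / M = ((e / M) `^ b^-1) `^ b.
    by rewrite -powRrM mulVf ?gt_eqF// powRr1// ltW// divr_gt0.
  by rewrite gt0_ltr_powR// nnegrE// powR_ge0.
rewrite ltr_pdivlMr// mulrC; apply: le_lt_trans.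
by rewrite ler_wpM2r ?powR_ge0// lerDl.
Unshelve. all: end_near. Qed.

Lemma lacunary01_derivable b c th t : 0 < b -> b < 1 -> has_moment (1 + b) c ->
  derivable01 (lacunary01 c th) t.
Proof.
move=> b0 b1 mb; apply/cvg_ex; eexists; exact: lacunary01_derive b0 b1 mb.
Qed.

Lemma derive01_lacunary b c th : 0 < b -> b < 1 -> has_moment (1 + b) c ->
  derive01 (lacunary01 c th)
  = lacunary01 (fun j => c j * freq j) (th + pi / 2).
Proof.
move=> b0 b1 mb; apply/funext => t; apply: cvg_lim => //.
exact: lacunary01_derive b0 b1 mb.
Qed.

(** For [k < n], the [k]-th derivative has a moment of order
    [(n - k) + b >= 1 + b], which [derive01_lacunary] needs. *)
Lemma derive01n_lacunary n b c th : 0 < b -> b < 1 -> has_moment (n%:R + b) c ->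
  forall k, (k <= n)%N -> derive01n k (lacunary01 c th)
  = lacunary01 (fun j => c j * freq j ^+ k) (th + k%:R * (pi / 2)).
Proof.
move=> b0 b1 mb; elim=> [_|k IH kn].
  rewrite mul0r addr0 /=; congr lacunary01.
  by apply/funext => j; rewrite mulr1.
rewrite [LHS]/= -/(derive01n _ _) IH ?(ltnW kn)//.
rewrite (@derive01_lacunary b)//; last first.
  rewrite /has_moment moment_term_shift; apply: has_moment_le mb.
  by rewrite addrA lerD2r natr1 ler_nat.
congr lacunary01; last first.
  by rewrite -[k.+1%:R]natr1 [X in _ = _ + X]mulrDl mul1r addrA.
by apply/funext => j; rewrite exprSr mulrA.
Qed.

Lemma derivable01_upto_lacunary n b c th : 0 < b -> b < 1 ->
  has_moment (n%:R + b) c -> derivable01_upto n (lacunary01 c th).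
Proof.
move=> b0 b1 mb k kn t.
rewrite (derive01n_lacunary _ b0 b1 mb) ?(ltnW kn)//.
apply: lacunary01_derivable b0 b1 _.
rewrite /has_moment moment_term_shift; apply: has_moment_le mb.
by rewrite addrA lerD2r natr1 ler_nat.
Qed.

Lemma frac_part_itv a : 0 < a -> a \isn't a Num.int ->
  0 < a - (Num.truncn a)%:R /\ a - (Num.truncn a)%:R < 1.
Proof.
move=> a0 aZ; have /andP[na an] := truncn_itv (ltW a0).
rewrite ltrBlDl natr1 an subr_gt0 lt_neqAle na andbT; split => //.
by apply: contraNneq aZ => <-; rewrite intr_nat.
Qed.

Lemma sup_norm_lacunary c th : has_moment 0 c ->
  (sup_norm (lacunary01 c th) <= (moment 0 c)%:E)%E.
Proof.
move=> m0; apply: ge_ereal_sup => _ [t _ <-].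
by rewrite lee_fin norm_lacunary.
Qed.

Lemma holder_seminorm_lacunary b c th : 0 < b -> b < 1 -> has_moment b c ->
  (holder_seminorm b (lacunary01 c th) <= (2 * moment b c)%:E)%E.
Proof.
move=> b0 b1 mb; apply: ge_ereal_sup => _ [[s t] /= st <-].
have vst : 0 < `|\val s - \val t|.
  by rewrite normr_gt0 subr_eq0; apply: contra_neq st => /val_inj.
by rewrite lee_fin ler_pdivrMr ?powR_gt0// lacunary_holder.
Qed.

(** The [truncn a + 1] sup norms contribute at most one moment each, and the
    seminorm two. *)
Lemma holder_norm_lacunary a c th : 0 < a -> a \isn't a Num.int ->
  has_moment a c ->
  (holder_norm a (lacunary01 c th)
   <= (((Num.truncn a)%:R + 3) * moment a c)%:E)%E.
Proof.
move=> a0 aZ ma; have [b0 b1] := frac_part_itv a0 aZ.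
set n := Num.truncn a in b0 b1 *; set b := a - n%:R in b0 b1 *.
have nb : n%:R + b = a by rewrite addrC subrK.
have mb : has_moment (n%:R + b) c by rewrite nb.
have -> : (n%:R + 3) * moment a c = moment a c *+ n.+1 + 2 * moment a c.
  by rewrite -[moment a c *+ _]mulr_natl -[n.+1%:R]natr1; ring.
rewrite /holder_norm -/n -/b EFinD; apply: leeD; last first.
  rewrite (derive01n_lacunary _ b0 b1 mb)//.
  apply: le_trans (holder_seminorm_lacunary _ b0 b1 _) _.
    by rewrite /has_moment moment_term_shift.
  by rewrite /moment moment_term_shift nb.
rewrite big_mkord.
apply: (@le_trans _ _ (\sum_(k < n.+1) (moment a c)%:E)%E); last first.
  by rewrite sumEFin sumr_const card_ord.
apply: lee_sum => k _; have kn : (k <= n)%N by rewrite -ltnS.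
have ka : k%:R + 0 <= a.
  by rewrite addr0 -nb; apply: ler_wpDr; [exact: ltW|rewrite ler_nat].
rewrite (derive01n_lacunary _ b0 b1 mb)//.
apply: le_trans (sup_norm_lacunary _ _) _.
  by rewrite /has_moment moment_term_shift; exact: has_moment_le ma.
by rewrite lee_fin /moment moment_term_shift; exact: moment_le.
Qed.

Lemma holder_lacunary a c th : 0 < a -> a \isn't a Num.int ->
  has_moment a c -> holder a (lacunary01 c th).
Proof.
move=> a0 aZ ma; have [b0 b1] := frac_part_itv a0 aZ.
split; last by rewrite (le_lt_trans (holder_norm_lacunary _ a0 aZ ma))// ltry.
apply: derivable01_upto_lacunary b0 b1 _.
by rewrite addrC subrK.
Qed.

End lacunary_series.

(** * Series with bounded digits *)
Section arithmetico_geometric.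
Context {R : realType}.
Implicit Types (r : R) (v : R ^nat).

Lemma sum_arith_geom r n : r != 1 ->
  series (fun j => j%:R * r ^+ j) n
  = r / (1 - r) ^+ 2 - r ^+ n * (n%:R / (1 - r) + r / (1 - r) ^+ 2).
Proof.
move=> r1; have r0 : 1 - r != 0 by rewrite subr_eq0 eq_sym.
elim: n => [|n IH]; first by rewrite seriesEnat /= big_geq// mul0r; field.
by rewrite seriesSr IH [r ^+ n.+1]exprS -[n.+1%:R]natr1; field.
Qed.

Lemma cvg_series_arith_geom r : 0 <= r -> r < 1 ->
  cvgn (series (fun j => j%:R * r ^+ j)).
Proof.
move=> r0 r1; have d0 : 0 < 1 - r by rewrite subr_gt0.
apply: nondecreasing_is_cvgn.
  by apply: nondecreasing_series => j _ _; rewrite mulr_ge0// exprn_ge0.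
exists (r / (1 - r) ^+ 2) => _ [n _ <-].
rewrite sum_arith_geom ?lt_eqF// gerBl mulr_ge0 ?exprn_ge0//.
by rewrite addr_ge0// divr_ge0// ?exprn_ge0// ltW.
Qed.

Lemma cvg_series_tail v n : cvgn (series v) ->
  series (fun j => if (j < n)%N then 0 else v j) m @[m --> \oo]
  --> limn (series v) - series v n.
Proof.
move=> cv.
have : (series v m - series v n) @[m --> \oo] --> limn (series v) - series v n.
  by apply: cvgB => //; exact: cvg_cst.
apply: cvg_trans; apply: near_eq_cvg; near=> m.
have nm : (n <= m)%N by near: m; exists n.
rewrite !seriesEnat /= !(big_cat_nat (leq0n n) nm)/= addrAC subrr add0r.
have -> : \sum_(0 <= j < n) (if (j < n)%N then 0 else v j) = 0 :> R.
  by rewrite big_nat_cond big1// => j; rewrite andbT /= => ->.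
rewrite add0r.
by apply: eq_big_nat => j /andP[nj _]; rewrite ltnNge nj.
Unshelve. all: end_near. Qed.

End arithmetico_geometric.

Section lacunary_family.
Context {R : realType} (h : R).
Implicit Types (d : nat -> nat) (a e : R) (c : R ^nat).

Definition amplitude : R := 2 `^ (- h).

(** Capping the [j]-th digit at [j] makes the series converge for every
    [d : nat -> nat], so that it is defined on the whole product space. *)
Definition digit_coef d j : R := (minn (d j) j)%:R * amplitude ^+ j.

(** [(2 * pi) `^ a * 2 `^ (a * j)] is [freq j `^ a], so this is the moment term
    of the largest admissible digits. *)
Definition moment_bound a j : R :=
  (2 * pi) `^ a * (j%:R * (2 `^ (a - h)) ^+ j).

Lemma amplitude_gt0 : 0 < amplitude.
Proof. by rewrite powR_gt0. Qed.

Lemma freq_powR a j : freq j `^ a = (2 * pi) `^ a * (2 `^ a) ^+ j :> R.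
Proof.
rewrite /freq exprS mulrAC.
rewrite [(_ * 2 ^+ j) `^ a]powRM ?exprn_ge0 ?mulr_ge0 ?pi_ge0//.
by congr (_ * _); rewrite -!powR_mulrn ?powR_ge0// -!powRrM mulrC.
Qed.

Lemma moment_term_le a c j : `|c j| <= j%:R * amplitude ^+ j ->
  moment_term a c j <= moment_bound a j.
Proof.
move=> cj; rewrite /moment_bound addrC powRD; last first.
  by rewrite pnatr_eq0 implybT.
rewrite exprMn [leRHS](_ : _ = j%:R * amplitude ^+ j * freq j `^ a).
  by rewrite ler_wpM2r// powR_ge0.
by rewrite freq_powR /amplitude; ring.
Qed.

Lemma moment_bound_ge0 a j : 0 <= moment_bound a j.
Proof. by rewrite !mulr_ge0 ?powR_ge0 ?exprn_ge0 ?powR_ge0. Qed.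

Lemma cvg_moment_bound a : a < h -> cvgn (series (moment_bound a)).
Proof.
move=> ah; apply: is_cvg_seriesZ; apply: cvg_series_arith_geom.
  exact: powR_ge0.
rewrite -opprB powRN invf_lt1 ?powR_gt0//.
rewrite [ltLHS](_ : _ = 1 `^ (h - a)); last by rewrite powR1.
by rewrite gt0_ltr_powR ?subr_gt0 ?nnegrE ?ltr1n.
Qed.

Lemma norm_digit_coef d j : `|digit_coef d j| <= j%:R * amplitude ^+ j.
Proof.
have q0 := ltW amplitude_gt0.
rewrite ger0_norm ?mulr_ge0 ?exprn_ge0// ler_wpM2r ?exprn_ge0//.
by rewrite ler_nat geq_minr.
Qed.

Lemma norm_digit_coefB d d' j :
  `|digit_coef d j - digit_coef d' j| <= j%:R * amplitude ^+ j.
Proof.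
have q0 := ltW amplitude_gt0.
rewrite -mulrBl normrM [X in _ * X]ger0_norm ?exprn_ge0//.
rewrite ler_wpM2r ?exprn_ge0// ler_norml.
have := geq_minr (d j) j; have := geq_minr (d' j) j.
rewrite -!(ler_nat R) => dj d'j.
by have := ler0n R (minn (d j) j); have := ler0n R (minn (d' j) j); lra.
Qed.

Lemma has_moment_digit a d : a < h -> has_moment a (digit_coef d).
Proof.
move=> ah; apply: series_le_cvg (cvg_moment_bound ah) => j.
- exact: moment_term_ge0.
- exact: moment_bound_ge0.
- exact: moment_term_le (norm_digit_coef d j).
Qed.

(** The difference of two series with the same first [n] digits is dominated by
    the tail of one convergent series, uniformly in the digits. *)
Lemma moment_digitB_small a e : a < h -> 0 < e -> exists n,
  forall d d', (forall j, (j < n)%N -> d j = d' j) ->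
  let c j := digit_coef d' j - digit_coef d j in
  has_moment a c /\ moment a c < e.
Proof.
move=> ah e0; have cv := cvg_moment_bound ah.
have /cvgrPdist_lt/(_ _ e0)[n _ /(_ n (leqnn n)) /= ne] := cv.
exists n => d d' dd'.
have cn j : moment_term a (fun j => digit_coef d' j - digit_coef d j) j <=
    (if (j < n)%N then 0 else moment_bound a j).
  case: ifPn => [jn|_]; last exact: moment_term_le (norm_digit_coefB _ _ _).
  by rewrite /moment_term /digit_coef dd'// subrr normr0 mul0r.
have ct := cvg_series_tail (n := n) cv.
have mc : has_moment a (fun j => digit_coef d' j - digit_coef d j).
  apply: series_le_cvg cn _ => [j|j|]; first exact: moment_term_ge0.
    case: ifP => // _.
    exact: moment_bound_ge0.
  by apply/cvg_ex; eexists; exact: ct.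
split=> //; apply: le_lt_trans (ler_norm _) _.
apply: le_lt_trans ne; rewrite -(cvg_lim _ ct)//.
apply: le_trans _ (ler_norm _).
rewrite ger0_norm ?moment_ge0//.
by apply: lim_series_le => //; apply/cvg_ex; eexists; exact: ct.
Qed.

Lemma lacunary01_digit_in d : 0 < h ->
  lacunary01 (digit_coef d) 0 \in in_holder_below h.
Proof.
move=> h0; rewrite inE => a /and3P[a0 ah aZ].
by apply: holder_lacunary => //; exact: has_moment_digit.
Qed.

End lacunary_family.

Section digit_function.
Context {R : realType} (h : R) (h0 : 0 < h).
Implicit Types (d : nat -> nat) (a e : R).

Definition digit_fun d : holder_below h :=
  HolderBelow (lacunary01_digit_in d h0).

Lemma digit_fun_close (s : seq R) e d : all (holder_exponent h) s -> 0 < e ->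
  exists n, forall d', (forall j, (j < n)%N -> d j = d' j) ->
  holder_ball s (digit_fun d) e (digit_fun d').
Proof.
move=> sh e0; elim: s sh => [_|a s IH /= /andP[/and3P[a0 ah aZ] sh]].
  by exists 0%N => d' _ a; rewrite in_nil.
have [n nB] := IH sh.
pose K : R := (Num.truncn a)%:R + 3.
have K0 : 0 < K by rewrite ltr_wpDl.
have [m mB] := moment_digitB_small ah (divr_gt0 e0 K0).
exists (maxn n m) => d' dd' b; rewrite inE => /predU1P[->{b}|bs]; last first.
  by apply: nB => // j jn; apply: dd'; rewrite leq_max jn.
have [|/= mc me] := mB d d'.
  by move=> j jm; apply: dd'; rewrite leq_max jm orbT.
rewrite [X in holder_norm a X](_ : _ =
    lacunary01 (fun j => digit_coef h d' j - digit_coef h d j) 0); last first.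
  apply/funext => t; rewrite /= /lacunary01 -lacunaryB//.
    exact: has_moment_digit.
  exact: has_moment_digit.
apply: le_lt_trans (holder_norm_lacunary _ a0 aZ mc) _.
by rewrite lte_fin mulrC -ltr_pdivlMr.
Qed.

(** Continuity in terms of prefixes. The measurability of the random function
    uses this form. *)
Lemma digit_fun_nbhs (A : set (holder_below h)) d : nbhs (digit_fun d) A ->
  exists n, forall d', (forall j, (j < n)%N -> d j = d' j) -> A (digit_fun d').
Proof.
move=> [[s e] /= [sh e0] BA]; have [n nB] := digit_fun_close d sh e0.
by exists n => d' /nB /BA.
Qed.

Lemma digit_fun_continuous :
  continuous (digit_fun : {ptws nat -> nat} -> holder_below h).
Proof.
move=> d A /digit_fun_nbhs[n nA]; rewrite nbhs_filterE.
suff : nbhs d [set d' : {ptws nat -> nat} | forall j, (j < n)%N -> d j = d' j].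
  by apply: filterS => d' /= /nA.
elim: n {nA} => [|n IH]; first by apply: filterS filterT => d' _ j.
have pn : nbhs d (@proj nat (fun=> nat) n @^-1` [set d n]).
  apply: proj_continuous; exact/principal_filterP.
apply: filterS2 IH pn => d' /= IH dn j; rewrite ltnS leq_eqVlt.
by move=> /predU1P[->|]; [exact: esym|exact: IH].
Qed.

End digit_function.

(** * Evaluation maps *)
Section holder_below_evaluation.
Context {R : realType} (h : R).
Implicit Types (t : I01 R) (a : R).

Lemma norm_le_holder_norm a (f : I01 R -> R) t :
  (`|f t|%:E <= holder_norm a f)%E.
Proof.
rewrite /holder_norm big_nat_recl// -addeA; apply: lee_paddr.
  apply: adde_ge0; last exact: holder_seminorm_ge0.
  by apply: sume_ge0 => k _; exact: sup_norm_ge0.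
by apply: ereal_sup_ubound; exists t.
Qed.

(** Evaluations are continuous for the topology of the space only because it is
    generated by at least one norm. *)
Lemma holder_exponent_ex : 0 < h -> exists a, holder_exponent h a.
Proof.
move=> h0; have m0 : 0 < Num.min h 1 by rewrite lt_min h0 ltr01.
have mh : Num.min h 1 <= h by rewrite ge_min lexx.
have m1 : Num.min h 1 <= 1 by rewrite ge_min lexx orbT.
exists (Num.min h 1 / 2); move: (Num.min h 1) m0 mh m1 => m m0 mh m1.
apply/and3P; split; [lra|lra|].
apply/negP => /intrP[z zE].
have z0 : (0 < z :> int) by rewrite -(ltr0z R) -zE; lra.
by have : m / 2 < 1 by [lra]; rewrite zE ltrz1 ltNge -gtz0_ge1 z0.
Qed.

Lemma evaluation_continuous t : 0 < h ->
  continuous (fun f : holder_below h => f t : R).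
Proof.
move=> /holder_exponent_ex[a ha] f A /nbhs_ballP[e /= e0 eA].
exists ([:: a], e); first by rewrite /= ha.
move=> g gB; apply: eA; rewrite -ball_normE /= distrC -lte_fin.
apply: le_lt_trans (gB a (mem_head _ _)).
exact: norm_le_holder_norm a _ t.
Qed.

Lemma holder_below_hausdorff : 0 < h -> hausdorff_space (holder_below h).
Proof.
move=> h0 f g fg; apply: val_inj; apply/funext => t.
apply: (@Rhausdorff R) => A B fA gB.
have [k [kA kB]] := fg _ _ (evaluation_continuous (t := t) h0 fA)
  (evaluation_continuous (t := t) h0 gB).
by exists (k t).
Qed.

Lemma closed_measurable (A : set (holder_below h)) : closed A ->
  measurable (A : set (borel_of (holder_below h))).
Proof.
move=> cA; rewrite -[A]setCK; apply: measurableC; apply: sub_gen_smallest.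
exact: closed_openC.
Qed.

End holder_below_evaluation.

(** * The law of the random series *)
Section random_function.
Context {R : realType} (h : R) (h0 : 0 < h).
Implicit Types (x : R) (d : nat -> nat).

(** For [x] in [0, 1), the index of the interval of length [1 / n!] that
    contains [x]. *)
Definition rank n x : nat := Num.truncn (n`!%:R * x).

Definition digit x i : nat := (rank i.+1 x %% i.+1)%N.

Lemma digit_le x i : (digit x i <= i)%N.
Proof. by rewrite -ltnS ltn_mod. Qed.

Lemma measurable_digit i k : measurable [set x | digit x i = k].
Proof.
have mtrunc m : measurable [set x : R | rank i.+1 x = m].
  have mle p : measurable [set x : R | (rank i.+1 x <= p)%N].
    rewrite (_ : mkset _ = `]-oo, p.+1%:R / i.+1`!%:R[%classic)//.
    apply/seteqP; split=> x /=;
      by rewrite in_itv /= /rank truncn_le_nat ltr_pdivlMr ?ltr0n ?fact_gt0//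
        mulrC.
  case: m => [|m].
    by rewrite (_ : mkset _ = [set x : R | (rank i.+1 x <= 0)%N])//;
      apply/seteqP; split=> x /=; rewrite leqn0 => /eqP.
  rewrite (_ : mkset _ = [set x : R | (rank i.+1 x <= m.+1)%N] `\`
     [set x : R | (rank i.+1 x <= m)%N]); first exact: measurableD.
  apply/seteqP; split=> x /=; first by move=> ->; rewrite leqnn ltnn.
  by move=> [xm /negP]; rewrite -ltnNge => mx; apply/eqP; rewrite eqn_leq xm.
rewrite (_ : mkset _ = \bigcup_(m in [set m | (m %% i.+1)%N = k])
    [set x : R | rank i.+1 x = m]); first exact: bigcup_measurable.
apply/seteqP; split=> x /=; first by exists (rank i.+1 x).
by move=> [m <- ] <-.
Qed.

Definition random_function (x : measurableTypeR R) :
    borel_of (holder_below h) :=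
  digit_fun h0 (digit x).

(** The preimage of an open set is a union of cylinders, one for each finite
    prefix all of whose extensions lie in the open set: such prefixes are
    countably many, and every point of an open set has one. *)
Lemma measurable_random_function : measurable_fun setT random_function.
Proof.
apply: (@measurability _ _ (measurableTypeR R) (borel_of (holder_below h)) setT
  random_function (@open (holder_below h)) erefl).
move=> _ [V oV <-]; rewrite setTI.
pose good (s : seq nat) := forall d,
  (forall i, (i < size s)%N -> nth 0%N s i = d i) -> V (digit_fun h0 d).
pose cyl s := [set x | forall i, (i < size s)%N -> digit x i = nth 0%N s i].
rewrite (_ : _ @^-1` _ = \bigcup_(s in good) cyl s).
  have mcyl s : measurable (cyl s).
    rewrite (_ : cyl s = \bigcap_(i in [set i | (i < size s)%N])
        [set x | digit x i = nth 0%N s i]) //.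
    by apply: bigcap_measurableType => i _; exact: measurable_digit.
  rewrite bigcup_mkcond; apply: countable_bigcupT_measurable => // s.
  case: ifP => _; [exact: mcyl|exact: measurable0].
apply/seteqP; split=> x /=.
  move=> Vx; have [n nV] := digit_fun_nbhs (open_nbhs_nbhs (conj oV Vx)).
  exists (mkseq (digit x) n) => [d|i]; rewrite size_mkseq => dn.
    by apply: nV => j jn; rewrite -dn// nth_mkseq.
  by rewrite nth_mkseq.
by move=> [s gs] xs; apply: gs => i /xs.
Qed.

HB.instance Definition _ :=
  isMeasurableFun.Build _ _ _ _ random_function measurable_random_function.

Definition random_law : probability (borel_of (holder_below h)) R :=
  distribution (uniform_prob (@ltr01 R)) random_function.

Lemma random_law_compactly_supported : compactly_supported random_law.
Proof.
pose D : set {ptws nat -> nat} :=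
  [set d | forall i, [set k | (k <= i)%N] (d i)].
pose K := (digit_fun h0 : {ptws nat -> nat} -> _) @` D.
have cK : compact K.
  apply: continuous_compact.
    by apply: continuous_subspaceT; exact: digit_fun_continuous.
  apply: (@tychonoff nat (fun=> nat) (fun i => [set k | (k <= i)%N])) => i.
  by apply: finite_compact; rewrite (_ : mkset _ = `I_i.+1).
exists K; split => //.
  apply: closed_measurable; apply: compact_closed cK.
  exact: holder_below_hausdorff.
rewrite /random_law /= /distribution /pushforward.
rewrite (_ : _ @^-1` _ = set0) ?measure0//.
apply/seteqP; split=> x //=; apply.
by exists (digit x) => // i; exact: digit_le.
Qed.

End random_function.

(** * Counting prefixes of digits *)
Section digit_counting.
Context {R : realType}.
Implicit Types (x y : R) (n i a C : nat) (L : seq nat).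

Lemma rank_div n x : 0 <= x -> rank n x = (rank n.+1 x %/ n.+1)%N.
Proof.
move=> x0; rewrite /rank factS natrM -mulrA.
have y0 : 0 <= n`!%:R * x by rewrite mulr_ge0.
move: (n`!%:R * x) y0 => y y0.
have /andP[Ty yT] := truncn_itv (mulr_ge0 (ler0n R n.+1) y0).
move: (Num.truncn _) Ty yT => T Ty yT.
apply: truncn_def; apply/andP; split.
  rewrite -(@ler_pM2l _ n.+1%:R) ?ltr0n// -natrM (le_trans _ Ty)//.
  by rewrite ler_nat mulnC leq_trunc_div.
rewrite -(@ltr_pM2l _ n.+1%:R) ?ltr0n// -natrM (lt_le_trans yT)//.
by rewrite ler_nat mulnC ltn_ceil.
Qed.

Lemma rankS n x : 0 <= x -> rank n.+1 x = (rank n x * n.+1 + digit x n)%N.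
Proof. by move=> x0; rewrite [in RHS](rank_div _ x0) /digit -divn_eq. Qed.

Lemma eq_digit n x y : 0 <= x -> 0 <= y -> rank n x = rank n y ->
  forall i, (i < n)%N -> digit x i = digit y i.
Proof.
move=> x0 y0; elim: n => // n IH xy i; rewrite ltnS leq_eqVlt.
move=> /predU1P[->|]; first by rewrite /digit xy.
by apply: IH; rewrite (rank_div n x0) (rank_div n y0) xy.
Qed.

Lemma rank_inv n a : rank n (a%:R / n`!%:R : R) = a.
Proof.
by rewrite /rank mulrC divfK ?natrK// pnatr_eq0 -lt0n fact_gt0.
Qed.

Definition first_digit (u : R) C : nat := Num.truncn ((- u - C%:R) / 2).

(** The admissible integers [a] lie in the interval of length [C] that starts at
    [(- u - C) / 2]. *)
Lemma first_digitP (u : R) C a : `|u + 2 * a%:R| <= C%:R ->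
  exists2 e, (e < C.+1)%N & a = (first_digit u C + e)%N.
Proof.
rewrite ler_norml => /andP[ua au]; rewrite /first_digit.
set v := (- u - C%:R) / 2.
have va : v <= a%:R by rewrite /v; lra.
have ka : (Num.truncn v <= a)%N by rewrite -[leqRHS](@natrK R) le_truncn.
exists (a - Num.truncn v)%N; last by rewrite subnKC.
rewrite ltn_subLR// -(ltr_nat R) natrD -[C.+1%:R]natr1.
by have := truncnS_gt v; rewrite -natr1 /v => ?; lra.
Qed.

(** Each further condition multiplies the number of prefixes by at most
    [C.+1], because its offset [u i] is fixed by the previous digits. The
    [J`!.+1] initial prefixes include the one of [x = 1]. *)
Lemma rank_cover (u : nat -> (nat -> nat) -> R) C J m :
  (forall i d d', (forall l, (l < i)%N -> d l = d' l) -> u i d = u i d') ->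
  exists L, size L = (J`!.+1 * C.+1 ^ m)%N /\
    forall x, 0 <= x <= 1 ->
      (forall i, (J <= i < J + m)%N ->
        `|u i (digit x) + 2 * (digit x i)%:R| <= C%:R) ->
      rank (J + m) x \in L.
Proof.
move=> uloc; elim: m => [|m [L [sL LP]]].
  exists (iota 0 J`!.+1); rewrite size_iota muln1; split=> // x.
  move=> /andP[x0 x1] _; rewrite addn0.
  by rewrite mem_iota /= add0n ltnS -[leqRHS](@natrK R) le_truncn// ler_piMr.
rewrite addnS; set n := (J + m)%N in LP *.
(* [a / n!] is a representative of the points of rank [a]: it has the same
   first [n] digits as all of them. *)
pose k a := first_digit (u n (digit (a%:R / n`!%:R : R))) C.
exists [seq (a * n.+1 + (k a + e))%N | a <- L, e <- iota 0 C.+1]; split.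
  by rewrite size_allpairs size_iota sL expnSr mulnA.
move=> x x01 xu; have /andP[x0 _] := x01.
have xL : rank n x \in L.
  apply: LP => // i /andP[Ji ilt]; apply: xu.
  by rewrite Ji ltnS ltnW.
have [e eC de] := first_digitP (xu n ltac:(by rewrite leq_addr leqnn)).
apply/allpairsP; exists (rank n x, e); split; [exact: xL|by rewrite mem_iota|].
rewrite /= rankS// de; congr (_ + (first_digit _ _ + _))%N.
apply: uloc => l ln; apply: eq_digit ln => //.
by rewrite rank_inv.
Qed.

Lemma lebesgue_rank_le n L (A : set (measurableTypeR R)) : measurable A ->
  (forall x, A x -> 0 <= x /\ rank n x \in L) ->
  (lebesgue_measure A <= ((size L)%:R / n`!%:R)%:E)%E.
Proof.
elim: L A => [|a L IH] A mA AL.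
  rewrite (_ : A = set0) ?measure0 ?mul0r//.
  by apply/seteqP; split=> // x /AL [].
have f0 : 0 < n`!%:R :> R by rewrite ltr0n fact_gt0.
pose I : set (measurableTypeR R) := `[a%:R / n`!%:R, a.+1%:R / n`!%:R]%classic.
have mI : measurable I by exact: measurable_itv.
rewrite (measureDI _ mA mI) /= -[(size L).+1%:R]natr1 mulrDl EFinD.
apply: leeD.
  apply: IH; first exact: measurableD.
  move=> x [/AL[x0]]; rewrite inE => /predU1P[xa|//] nI; exfalso; apply: nI.
  rewrite /I /= in_itv /= ler_pdivrMr// ler_pdivlMr// mulrC -xa.
  have /andP[xl xr] := truncn_itv (mulr_ge0 (ltW f0) x0).
  by rewrite xl ltW.
apply: (@le_trans _ _ (lebesgue_measure I)).
  by apply: le_measure; rewrite ?inE//; exact: measurableI.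
rewrite lebesgue_measure_itv /= lte_fin ltr_pM2r ?invr_gt0// ltr_nat ltnSn.
by rewrite -EFinD lee_fin -mulrBl -natr1 addrAC subrr add0r.
Qed.

Lemma uniform_prob_le_lebesgue (A : set (measurableTypeR R)) : measurable A ->
  (uniform_prob (@ltr01 R) A <= lebesgue_measure (A `&` `[0%R, 1%R]))%E.
Proof.
move=> mA; rewrite /uniform_prob integral_uniform_pdf.
have mA01 : measurable (A `&` `[0, 1]) by exact: measurableI.
rewrite (eq_integral (cst 1%E)); first by rewrite integral_cst// mul1e.
move=> x; rewrite inE => -[_ /=]; rewrite in_itv /= /uniform_pdf => ->.
by rewrite subr0 invr1.
Qed.

End digit_counting.

(** * Dyadic increments *)
Section dyadic_increments.
Context {R : realType}.
Implicit Types (c : R ^nat) (i k l n : nat).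

Definition dyadic i k : I01 R := insubd (I01_0 R) (k%:R / 2 ^+ i).

Lemma val_dyadic i k : (k <= 2 ^ i)%N -> \val (dyadic i k) = k%:R / 2 ^+ i.
Proof.
move=> ki; rewrite insubdK// inE /unit_interval /= in_itv /= divr_ge0//=.
by rewrite ler_pdivrMr ?exprn_gt0// mul1r -natrX ler_nat.
Qed.

Lemma cos_nat2pi k : cos (k%:R * (pi *+ 2)) = 1 :> R.
Proof.
rewrite mulr_natl -[_ *+ k]add0r.
by rewrite (periodicn (@cosD2pi R)) cos0.
Qed.

Lemma cos_freq_dyadic i k l : (i <= l)%N ->
  cos (freq l * (k%:R / 2 ^+ i) + 0) = 1 :> R.
Proof.
move=> il; rewrite -[RHS](cos_nat2pi (k * 2 ^ (l - i))) addr0; congr cos.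
have e : 2 ^+ l = 2 ^+ (l - i) * 2 ^+ i :> R by rewrite -exprD subnK.
have n0 : 2 ^+ i != 0 :> R by rewrite expf_neq0 ?pnatr_eq0.
by rewrite /freq exprS e natrM natrX -[pi *+ 2]mulr_natl; field.
Qed.

(** The midpoint of a dyadic interval of length [2 ^- i] lies at an odd multiple
    of half a period of the [i]-th cosine. *)
Lemma cos_freq_mid i k :
  cos (freq i * (k.*2.+1%:R / 2 ^+ i.+1) + 0) = -1 :> R.
Proof.
have n0 : 2 ^+ i.+1 != 0 :> R by rewrite expf_neq0 ?pnatr_eq0.
have -> : freq i * (k.*2.+1%:R / 2 ^+ i.+1) + 0 = pi + (pi *+ 2) *+ k :> R.
  rewrite /freq -[k.*2.+1%:R]natr1 -muln2 natrM.
  rewrite -[pi *+ 2]mulr_natr -[_ *+ k]mulr_natr.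
  by field; exact: n0.
by rewrite (periodicn (@cosD2pi R)) cospi.
Qed.

Lemma lim_series_finite (v : R ^nat) n : (forall l, (n <= l)%N -> v l = 0) ->
  limn (series v) = series v n.
Proof.
move=> v0; apply: cvg_lim => //; apply: cvg_near_cst; near=> m.
have nm : (n <= m)%N by near: m; exists n.
rewrite !seriesEnat /= (big_cat_nat (leq0n n) nm)/=.
rewrite [X in _ + X]big_nat_cond [X in _ + X]big1 ?addr0// => l.
by rewrite andbT => /andP[/v0].
Unshelve. all: end_near. Qed.

(** For an index greater than [i], both points are multiples of the period. *)
Lemma lacunary_dyadic_increment c i k : has_moment 0 c -> (k < 2 ^ i)%N ->
  lacunary01 c 0 (dyadic i.+1 k.*2.+1) - lacunary01 c 0 (dyadic i k) =
  \sum_(0 <= l < i) c l * (cos (freq l * (k.*2.+1%:R / 2 ^+ i.+1) + 0)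
                           - cos (freq l * (k%:R / 2 ^+ i) + 0)) - 2 * c i.
Proof.
move=> mc ki; rewrite /lacunary01 !val_dyadic ?(ltnW ki)//; last first.
  by rewrite expnS mul2n ltn_double.
rewrite /lacunary -lim_seriesB; [|exact: cvg_lacunary|exact: cvg_lacunary].
rewrite (@lim_series_finite _ i.+1); last first.
  move=> l il; rewrite !fctE (cos_freq_dyadic _ il).
  by rewrite (cos_freq_dyadic _ (ltnW il)) subrr.
rewrite seriesEnat /= big_nat_recr//= !fctE cos_freq_mid cos_freq_dyadic//.
congr (_ + _); last by ring.
by apply: eq_big_nat => l _; rewrite -mulrBr.
Qed.

End dyadic_increments.

Section slow_functions.
Context {R : realType} (h : R).
Implicit Types (f g : I01 R -> R) (C J n i k : nat).

Definition small_increment f C i k :=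
  `|f (dyadic i.+1 k.*2.+1) - f (dyadic i k)| <= C%:R * amplitude h ^+ i.

(** [k %/ 2 ^ (n - i)] is the index of the ancestor of length [2 ^- i] of the
    [k]-th dyadic interval of length [2 ^- n]. Using the ancestors of a single
    interval leaves [2 ^ n] cases, instead of a product of such numbers. *)
Definition slow_along f C J n k :=
  forall i, (J <= i < n)%N -> small_increment f C i (k %/ 2 ^ (n - i)).

(** No point [t] occurs here, so that this superset of the functions that belong
    to some C^h(t) is described by countably many evaluations. *)
Definition slow f C J :=
  forall n, exists k, (k < 2 ^ n)%N /\ slow_along f C J n k.

Lemma dyadic_ancestor n i k : (i <= n)%N -> (k < 2 ^ n)%N ->
  (k %/ 2 ^ (n - i) < 2 ^ i)%N.
Proof. by move=> ni kn; rewrite ltn_divLR ?expn_gt0// -expnD subnKC. Qed.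

(** The index is the integer part of [2 ^ n * t], except for [t = 1], which is
    the right end of the last interval. *)
Lemma dyadic_cell_ex n (t : I01 R) :
  exists k, (k < 2 ^ n)%N /\ k%:R / 2 ^+ n <= \val t <= k.+1%:R / 2 ^+ n.
Proof.
have /andP[t0 t1] := I01P t.
have p0 : 0 < 2 ^+ n :> R by rewrite exprn_gt0.
have [tlt|tge] := ltP (\val t) 1.
  have y0 : 0 <= 2 ^+ n * \val t by exact: mulr_ge0 (ltW p0) t0.
  have /andP[yl yr] := truncn_itv y0.
  exists (Num.truncn (2 ^+ n * \val t)); split.
    by rewrite -(ltr_nat R) natrX (le_lt_trans yl)// gtr_pMr.
  by rewrite ler_pdivrMr// ler_pdivlMr// [\val t * _]mulrC yl ltW.
exists (2 ^ n).-1; rewrite prednK ?expn_gt0//; split => //.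
rewrite natrX divff ?gt_eqF// t1 andbT (le_trans _ tge)//.
by rewrite ler_pdivrMr// mul1r -natrX ler_nat leq_pred.
Qed.

Lemma ancestor_cell n i k (x : R) : (i <= n)%N ->
  k%:R / 2 ^+ n <= x <= k.+1%:R / 2 ^+ n ->
  (k %/ 2 ^ (n - i))%:R / 2 ^+ i <= x <= (k %/ 2 ^ (n - i)).+1%:R / 2 ^+ i.
Proof.
move=> ni /andP[kx xk]; have p0 m : 0 < 2 ^+ m :> R by rewrite exprn_gt0.
have e : 2 ^+ n = 2 ^+ (n - i) * 2 ^+ i :> R by rewrite -exprD subnK.
have q (z : R) : z / 2 ^+ i = z * 2 ^+ (n - i) / 2 ^+ n.
  by rewrite e; field; rewrite !gt_eqF.
rewrite !q; apply/andP; split.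
  apply: le_trans kx; rewrite ler_pM2r ?invr_gt0// -natrX -natrM ler_nat.
  exact: leq_trunc_div.
apply: le_trans xk _; rewrite ler_pM2r ?invr_gt0// -natrX -natrM ler_nat.
by rewrite ltn_ceil// expn_gt0.
Qed.

(** The left end and the midpoint of a dyadic interval of length [2 ^- i] that
    contains [t] are both within [2 ^- i] of [t]. *)
Lemma pointwise_holder_slow f (t : I01 R) : 0 < h -> pointwise_holder h t f ->
  exists C J, slow f C J.
Proof.
move=> h0; rewrite /pointwise_holder /= limf_esupE => /ereal_inf_lt.
move=> [_ [A At <-] Alty].
have [M M0 MA] : exists2 M : R, 0 <= M & forall s, A s ->
    `|f s - f t| / `|\val s - \val t| `^ h <= M.
  set S := ereal_sup _ in Alty.
  have [M M0 SM] : exists2 M : R, 0 <= M & (S <= M%:E)%E.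
    case: S Alty => [r||] // _; last by exists 0 => //; exact: leNye.
    by exists (Num.max 0 r); rewrite ?lee_fin le_max lexx ?orbT.
  exists M => // s As; rewrite -lee_fin; apply: le_trans SM.
  by apply: ereal_sup_ubound; exists s.
have [J JA] : exists J : nat, forall s,
    `|\val s - \val t| <= 2 ^- J -> s != t -> A s.
  move: At; rewrite /dnbhs /within /= => -[V [[W oW WV] Vt] VA].
  have Wt : W (\val t) by rewrite -[W _]/((set_val @^-1` W) t) WV.
  have /nbhs_ballP[e /= e0 eW] : nbhs (\val t) W by exact: open_nbhs_nbhs.
  have [J _ /(_ J (leqnn J)) /= Je] :
      \forall J \near \oo, `|0 - (2^-1 : R) ^+ J| < e.
    have half1 : `|2^-1 : R| < 1.
      by rewrite gtr0_norm ?invr_gt0// invf_lt1// ltr1n.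
    by have /cvgrPdist_lt := cvg_expr half1; exact.
  exists J => s sJ st; apply: VA => //; rewrite -WV; apply: eW.
  rewrite -ball_normE /= distrC (le_lt_trans sJ)//.
  by move: Je; rewrite sub0r normrN ger0_norm ?exprn_ge0 ?invr_ge0// exprVn.
have near_small s i : (J <= i)%N -> `|\val s - \val t| <= 2 ^- i ->
    `|f s - f t| <= M * amplitude h ^+ i.
  move=> Ji si; have q0 : 0 <= amplitude h ^+ i.
    by rewrite exprn_ge0// ltW// amplitude_gt0.
  have [->|st] := eqVneq s t; first by rewrite subrr normr0 mulr_ge0.
  have st0 : 0 < `|\val s - \val t|.
    by rewrite normr_gt0 subr_eq0; apply: contra_neq st => /val_inj.
  have As : A s.
    apply: JA => //; apply: le_trans si _.
    by rewrite lef_pV2 ?posrE ?exprn_gt0// ler_eXn2l ?ltr1n//.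
  have := MA s As; rewrite ler_pdivrMr ?powR_gt0// => /le_trans; apply.
  rewrite ler_wpM2l//.
  apply: (@le_trans _ _ ((2 ^- i) `^ h)).
    by rewrite ge0_ler_powR ?nnegrE ?invr_ge0 ?exprn_ge0// ltW.
  rewrite /amplitude -!powR_mulrn ?powR_ge0// -powRN -!powRrM.
  by rewrite !mulNr mulrC.
(* [2 * M]: each of the two points contributes [M * 2 `^ (- h * i)]. *)
exists (Num.truncn (2 * M)).+1, J => n.
have [k [kn kt]] := dyadic_cell_ex n t.
exists k; split=> // i /andP[Ji ilt]; have ni := ltnW ilt.
have ki := dyadic_ancestor ni kn; have := ancestor_cell ni kt.
rewrite /small_increment; move: (k %/ _)%N ki => p pi /andP[pt tp].
have p0 : 0 < 2 ^+ i :> R by rewrite exprn_gt0.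
have fp : `|f (dyadic i p) - f t| <= M * amplitude h ^+ i.
  apply: near_small => //; rewrite val_dyadic ?(ltnW pi)// distrC.
  rewrite ger0_norm ?subr_ge0// lerBlDr (le_trans tp)//.
  by rewrite -natr1 mulrDl mul1r addrC.
have fq : `|f (dyadic i.+1 p.*2.+1) - f t| <= M * amplitude h ^+ i.
  apply: near_small => //; rewrite val_dyadic; last first.
    by rewrite expnS mul2n ltn_double.
  have -> : p.*2.+1%:R / 2 ^+ i.+1 = (p%:R + 1 / 2) / 2 ^+ i :> R.
    rewrite exprS -[p.*2.+1%:R]natr1 -muln2 natrM.
    by field; rewrite gt_eqF.
  move: pt tp; rewrite -[p.+1%:R]natr1 !mulrDl mul1r div1r.
  have : 0 < (2 ^+ i)^-1 :> R by rewrite invr_gt0.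
  move: ((2 ^+ i)^-1) => z; move: (p%:R * z) => y z0 yt ty.
  by rewrite ler_norml; apply/andP; split; lra.
rewrite (_ : f _ - f _ =
  (f (dyadic i.+1 p.*2.+1) - f t) - (f (dyadic i p) - f t)).
  rewrite (le_trans (ler_normB _ _))// (le_trans (lerD fq fp))//.
  have -> : M * amplitude h ^+ i + M * amplitude h ^+ i
      = 2 * M * amplitude h ^+ i by ring.
  by rewrite ler_wpM2r ?exprn_ge0 ?ltW ?amplitude_gt0// truncnS_gt.
by rewrite opprB addrA subrK.
Qed.

End slow_functions.

(** * Almost surely, no slow increments *)
Section random_increments.
Context {R : realType} (h : R) (h0 : 0 < h).
Implicit Types (g : I01 R -> R) (C J n i k : nat) (d : nat -> nat).

(** The part of the normalized increment of [g - X] that does not depend on the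
    [i]-th digit. *)
Definition increment_offset g i k d : R :=
  (g (dyadic i.+1 k.*2.+1) - g (dyadic i k)
   - \sum_(0 <= l < i) digit_coef h d l *
       (cos (freq l * (k.*2.+1%:R / 2 ^+ i.+1) + 0)
        - cos (freq l * (k%:R / 2 ^+ i) + 0))) / amplitude h ^+ i.

Lemma increment_offset_local g i k d d' :
  (forall l, (l < i)%N -> d l = d' l) ->
  increment_offset g i k d = increment_offset g i k d'.
Proof.
move=> dd'; rewrite /increment_offset; congr ((_ - _) / _).
by apply: eq_big_nat => l /dd' dl; rewrite /digit_coef dl.
Qed.

Lemma small_increment_digit g C i k d : (k < 2 ^ i)%N -> (d i <= i)%N ->
  small_increment h (fun t => digit_fun h0 d t - g t) C i k ->
  `|increment_offset g i k d + 2 * (d i)%:R| <= C%:R.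
Proof.
move=> ki di; have q0 : 0 < amplitude h ^+ i.
  by rewrite exprn_gt0// amplitude_gt0.
have mc : has_moment 0 (digit_coef h d) by exact: has_moment_digit.
have := lacunary_dyadic_increment mc ki.
rewrite /small_increment /increment_offset.
rewrite -[digit_fun h0 d (dyadic i.+1 _)]/(lacunary01 _ _ _).
rewrite -[digit_fun h0 d (dyadic i k)]/(lacunary01 _ _ _).
rewrite /digit_coef (minn_idPl di) -/(digit_coef h d).
move: (lacunary01 _ _ _) (lacunary01 _ _ _) (\sum_(_ <= l < _) _) => b a S abS.
have -> : a - g (dyadic i.+1 k.*2.+1) - (b - g (dyadic i k)) =
   - (amplitude h ^+ i * ((g (dyadic i.+1 k.*2.+1) - g (dyadic i k) - S)
      / amplitude h ^+ i + 2 * (d i)%:R)).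
  have -> : a = S - 2 * ((d i)%:R * amplitude h ^+ i) + b by rewrite -abS subrK.
  by field; rewrite gt_eqF.
by rewrite normrN normrM (gtr0_norm q0) [leRHS]mulrC ler_pM2l.
Qed.

Lemma measurable_slow g C J :
  measurable ([set f : holder_below h | slow h (fun t => f t - g t) C J]
              : set (borel_of (holder_below h))).
Proof.
rewrite (_ : mkset _ = \bigcap_n \bigcup_(k in [set k | (k < 2 ^ n)%N])
    \bigcap_(i in [set i | (J <= i < n)%N])
    [set f : holder_below h |
      small_increment h (fun t => f t - g t) C i (k %/ 2 ^ (n - i))]).
  apply: bigcapT_measurable => n; apply: bigcup_measurable => k _.
  apply: bigcap_measurableType => i _.
  move: (k %/ _)%N => {}k; apply: closed_measurable.
  rewrite /small_increment; set q := dyadic _ _; set p := dyadic _ _.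
  apply: (@closed_comp _ _ (fun f : holder_below h =>
     `|f q - g q - (f p - g p)|) [set r | r <= C%:R * amplitude h ^+ i]).
    move=> f _.
    apply: (@continuous_comp _ _ _
      (fun f : holder_below h => f q - g q - (f p - g p)) Num.norm f).
      apply: (@continuousB R _ (holder_below h)).
        apply: (@continuousB R _ (holder_below h)); last exact: cst_continuous.
        exact: evaluation_continuous.
      apply: (@continuousB R _ (holder_below h)); last exact: cst_continuous.
      exact: evaluation_continuous.
    exact: norm_continuous.
  exact: closed_le.
apply/seteqP; split=> f /= fs n.
  by move=> _; have [k [kn ks]] := fs n; exists k.
by have [k kn ks] := fs n I; exists k.
Qed.

Lemma measurable_random_slow g C J : measurable ([set x |
    slow h (fun t => (random_function h0 x : holder_below h) t - g t) C J]
  : set (measurableTypeR R)).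
Proof.
have := measurable_random_function h0 measurableT (measurable_slow g C J).
by rewrite setTI.
Qed.

(** The union bound over the [2 ^ n] dyadic intervals gives a probability of at
    most [(J! + 1) * (2 * (C + 1)) ^ n / n!] for every [n >= J], and these are
    multiples of the terms of an exponential series. *)
Lemma random_slow_null g C J :
  uniform_prob (@ltr01 R) [set x |
    slow h (fun t => (random_function h0 x : holder_below h) t - g t) C J]
  = 0%E.
Proof.
set E := mkset _.
have mE : measurable (E : set (measurableTypeR R)).
  exact: measurable_random_slow.
have [L LP] : exists L : nat -> seq nat, forall m,
    size (L m) = (2 ^ (J + m) * (J`!.+1 * C.+1 ^ m))%N /\
    forall x, 0 <= x <= 1 -> E x -> rank (J + m) x \in L m.
  suff /choice[L LP] : forall m, exists L : seq nat,
      size L = (2 ^ (J + m) * (J`!.+1 * C.+1 ^ m))%N /\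
      forall x, 0 <= x <= 1 -> E x -> rank (J + m) x \in L by exists L.
  move=> m; set n := (J + m)%N.
  have /choice[L LP] k := @rank_cover R
    (fun i => increment_offset g i (k %/ 2 ^ (n - i))) C J m
    (fun i => @increment_offset_local g i (k %/ 2 ^ (n - i))).
  exists (flatten [seq L k | k <- iota 0 (2 ^ n)]); split.
    rewrite size_flatten /shape -map_comp (eq_map (fun k => (LP k).1)).
    rewrite sumnE big_map big_const_seq count_predT size_iota.
    by rewrite iter_addn_0 mulnC.
  move=> x x01 /(_ n)[k [kn ks]]; apply/flatten_mapP; exists k.
    by rewrite mem_iota.
  apply: (LP k).2 => // i /[dup] iJm /andP[Ji ilt].
  apply: small_increment_digit; [|exact: digit_le|exact: ks].
  by apply: dyadic_ancestor => //; exact: ltnW.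
pose y : R := 2 * C.+1%:R.
pose K : R := J`!.+1%:R.
have PE n : (J <= n)%N ->
    (uniform_prob (@ltr01 R) E <= (K * exp_coeff y n)%:E)%E.
  move=> Jn; apply: le_trans (uniform_prob_le_lebesgue mE) _.
  have mE01 : measurable ((E : set (measurableTypeR R)) `&` `[0, 1]).
    exact: measurableI.
  have [sL LE] := LP (n - J)%N; rewrite subnKC// in sL LE.
  apply: le_trans (lebesgue_rank_le (n := n) (L := L (n - J)%N) mE01 _) _.
    move=> x [Ex /=]; rewrite in_itv /= => x01.
    by split; [case/andP: x01|exact: LE].
  rewrite lee_fin sL exp_coeffE /=.
  have -> : K * (n`!%:R^-1 * y ^+ n) =
      (2 ^ n * (J`!.+1 * C.+1 ^ n))%N%:R / n`!%:R.
    by rewrite /K /y exprMn !natrM !natrX; ring.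
  rewrite ler_pM2r ?invr_gt0 ?ltr0n ?fact_gt0// ler_nat.
  by rewrite !leq_pmul2l ?expn_gt0// leq_pexp2l// leq_subr.
have Efin : uniform_prob (@ltr01 R) E \is a fin_num by exact: fin_num_measure.
apply/eqP; rewrite eq_le measure_ge0 andbT -(fineK Efin) lee_fin.
have cu : K * exp_coeff y n @[n --> \oo] --> (0 : R).
  rewrite -(mulr0 K); apply: cvgM; first exact: cvg_cst.
  exact: cvg_exp_coeff.
rewrite -[leRHS](cvg_lim _ cu)//; apply: limr_ge.
  by apply/cvg_ex; exists 0.
near=> n; rewrite -lee_fin fineK//; apply: PE.
by near: n; exists J.
Unshelve. all: end_near. Qed.

End random_increments.

Theorem proposition6p3 (R : realType) (h : R) (h_gt0 : 0 < h) :
  prevalent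
    [set f : holder_below h |
      forall t : I01 R, ~ pointwise_holder h t (f : I01 R -> R)].
Proof.
pose slow_set C J : set (holder_below h) :=
  [set f | slow h (fun t => f t - (0 : I01 R -> R) t) C J].
exists (\bigcup_C \bigcup_J slow_set C J); last first.
  move=> f /= /existsNP[t /contrapT] /(pointwise_holder_slow h_gt0)[C [J fs]].
  exists C => //; exists J => //; rewrite /slow_set /=.
  by rewrite (_ : (fun t => _) = f)//; apply/funext => s; rewrite subr0.
split.
  apply: bigcupT_measurable => C; apply: bigcupT_measurable => J.
  exact: measurable_slow.
exists (random_law h_gt0); split; first exact: random_law_compactly_supported.
move=> g; rewrite /random_law /= /distribution /pushforward.
rewrite (_ : _ @^-1` _ = \bigcup_C \bigcup_J [set x |
  slow h (fun t => (random_function h_gt0 x : holder_below h) t - g t) C J]).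
  apply: measure_negligible.
    apply: bigcupT_measurable => C; apply: bigcupT_measurable => J.
    exact: measurable_random_slow.
  apply: negligible_bigcup => C; apply: negligible_bigcup => J.
  by apply/negligibleP; [exact: measurable_random_slow|exact: random_slow_null].
apply/seteqP; split=> x /=.
  move=> [a [C _ [J _ aB]] gax]; exists C => //; exists J => //=.
  rewrite (_ : (fun t => _) = (fun t => a t - (0 : I01 R -> R) t))//.
  apply/funext => t; transitivity (g t + a t - g t).
    by congr (_ - _); exact: esym (congr1 (fun f : holder_below h => f t) gax).
  by rewrite addrAC subrr add0r subr0.
move=> [C _ [J _ xs]]; exists ((random_function h_gt0 x : holder_below h) - g).
  exists C => //; exists J => //; rewrite /slow_set /=.
  rewrite (_ : (fun t => _) =
    (fun t => (random_function h_gt0 x : holder_below h) t - g t))//.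
  by apply/funext => t; rewrite /= subr0.
by rewrite addrC subrK.
Qed.
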